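(* Let $\mathbf x(t)=(x(t),y(t),z(t))$ be a $C^1$ trajectory of the Lorenz system $$\dot x=\sigma(y-x),\qquad \dot y=x(\rho-z)-y,\qquad \dot z=xy-\beta z,$$ where $\sigma,\rho,\beta\in\mathbb R$ are unknown parameters. (i) Fix a time $t_0$ and suppose the values $x,y,z,\dot x,\dot y,\dot z$ at $t_0$ are observed. If $y(t_0)\ne x(t_0)$, $x(t_0)\neq0$ and $z(t_0)\ne0$, then $(\sigma,\rho,\beta)$ is uniquely determined by (all quantities evaluated at $t_0$) $$\sigma=\frac{\dot x}{y-x},\qquad \rho=\frac{\dot y+xz+y}{x},\qquad \beta=\frac{xy-\dot z}{z}.$$ (ii) Let $\mathcal S=\{(x,y,z)\in\mathbb R^3: y=x\text{ or }x=0\text{ or }z=0\}$ and, for $\delta>0$, $\mathcal S_\delta=\{\mathbf x\in\mathbb R^3: d(\mathbf x,\mathcal S)\ge\delta\}$. Let $\theta_i=(\sigma_i,\rho_i,\beta_i)$, $i=1,2$, be two parameter vectors such that corresponding Lorenz trajectories $\mathbf x_i$ satisfy $\mathbf x_i(t)\in\mathcal S_\delta$ for all $t\in\mathcal I$. Then $$\|\theta_1-\theta_2\|_{\mathbb R^3}\le C_{\delta,M}\,\|\mathbf x_1-\mathbf x_2\|_{C^1_{bd}(\mathcal I;\mathbb R^3)},\qquad (\mathrm W)$$ where $M=\max_{i=1,2}\|\mathbf x_i\|_{C^1_{bd}(\mathcal I;\mathbb R^3)}$ and $C_{\delta,M}$ is a constant depending on $\delta$ and $M$. (iii) If the trajectory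 is the equilibrium $(x(t),y(t),z(t))=(0,0,0)$ for all $t$, then none of the parameters $\sigma,\rho,\beta$ is identifiable. If the trajectory is one of the two nontrivial equilibria $\big(\pm\sqrt{\beta(\rho-1)},\pm\sqrt{\beta(\rho-1)},\rho-1\big)$, then $\beta$ and $\rho$ are uniquely identifiable while $\sigma$ is not identifiable. (iv) For the trajectory $x(t)=y(t)=0$, $z(t)=e^{-\beta t}z(0)$ with $z(0)\ne0$, only the parameter $\beta$ is identifiable. (v) Assume $\sigma\ne0$ and $\rho\neq0$. If $\mathbf x(\cdot)$ is any trajectory of the Lorenz system, then, unless it is an equilibrium point or a trajectory as in (iv), there exist a (nontrivial) interval $\mathcal I$ and $\delta>0$ such that $\{\mathbf x(t):t\in\mathcal I\}\subset\mathcal S_\delta$, in which case the well-posedness estimate $(\mathrm W)$ holds.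
   Context: $d(\cdot,\mathcal S)$ is Euclidean distance to $\mathcal S$. $C^1_{bd}(\mathcal I;\mathbb R^3)$ is the space of $C^1$ functions $\mathbf x:\mathcal I\to\mathbb R^3$ with finite norm $\|\mathbf x\|_{C^1_{bd}}=\sup_{t\in\mathcal I}\|\mathbf x(t)\|+\sup_{t\in\mathcal I}\|\dot{\mathbf x}(t)\|$. A parameter component is identifiable from a given (fully observed) trajectory if any two parameter vectors for which that same function of time solves the Lorenz system have the same value of that component. The nontrivial equilibria (same sign chosen in the first two coordinates) exist when $\rho>1$, $\beta>0$. In (v), estimate $(\mathrm W)$ is meant as in (ii), i.e. for pairs of Lorenz trajectories lying in $\mathcal S_\delta$ on $\mathcal I$. *)

(* Defs.v *)
From HB Require Import structures.
From mathcomp Require Import all_boot all_order all_algebra.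
From mathcomp Require Import all_classical all_reals all_analysis.
Set Implicit Arguments.
Unset Strict Implicit.
Unset Printing Implicit Defensive.
Import Order.TTheory GRing.Theory Num.Theory.
Import numFieldNormedType.Exports.
Local Open Scope classical_set_scope.
Local Open Scope ring_scope.

Section R3.
Context {R : realType}.

Definition vec3 (a b c : R) : 'rV[R]_3 := \row_(i < 3) [:: a; b; c]`_i.

(* The library norm on 'rV[R]_3 is the sup norm, hence a separate Euclidean
   norm. The two induce the same topology, so limits are unaffected. *)
Definition enorm (v : 'rV[R]_3) : R := Num.sqrt (\sum_(i < 3) v 0 i ^+ 2).

Definition euclid_dist (p : 'rV[R]_3) (A : set 'rV[R]_3) : R :=
  inf [set enorm (p - q) | q in A].

Definition xco (p : 'rV[R]_3) : R := p 0 (inord 0).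
Definition yco (p : 'rV[R]_3) : R := p 0 (inord 1).
Definition zco (p : 'rV[R]_3) : R := p 0 (inord 2).

End R3.

(* Positions of the components of a parameter vector (sigma, rho, beta). *)
Definition isigma : 'I_3 := inord 0.
Definition irho : 'I_3 := inord 1.
Definition ibeta : 'I_3 := inord 2.

Section C1.
Context {R : realType}.
Implicit Types (J : set R) (x : R -> 'rV[R]_3).

(* Intervals may be open, closed, half-open, bounded or not. *)
Definition nontrivial_interval J : Prop :=
  is_interval J /\ exists a b, [/\ J a, J b & a < b].

Definition diff_quotient x (t s : R) : 'rV[R]_3 := (s - t)^-1 *: (x s - x t).

(* The limit is taken along s in J only: the derivative is one-sided at an
   endpoint belonging to J. *)
Definition derivable_on J x : Prop :=
  forall t, J t -> cvg (diff_quotient x t @ within J t^').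

Definition derivative_on J x (t : R) : 'rV[R]_3 :=
  lim (diff_quotient x t @ within J t^').

Definition C1_on J x : Prop :=
  derivable_on J x /\ {within J, continuous (derivative_on J x)}.

Definition C1bd J x : Prop :=
  [/\ C1_on J x,
      has_ubound [set enorm (x t) | t in J] &
      has_ubound [set enorm (derivative_on J x t) | t in J]].

(* Meaningful for x in C1bd J, where both suprema are finite. *)
Definition C1bd_norm J x : R :=
  sup [set enorm (x t) | t in J] +
  sup [set enorm (derivative_on J x t) | t in J].

End C1.

Section Lorenz.
Context {R : realType}.
Implicit Types (J : set R) (x : R -> 'rV[R]_3) (theta p : 'rV[R]_3).

Definition lorenz_field theta p : 'rV[R]_3 :=
  vec3 (theta 0 isigma * (yco p - xco p))
       (xco p * (theta 0 irho - zco p) - yco p)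
       (xco p * yco p - theta 0 ibeta * zco p).

Definition lorenz_trajectory theta J x : Prop :=
  C1_on J x /\
  forall t, J t -> derivative_on J x t = lorenz_field theta (x t).

Definition equilibrium_trajectory theta J x : Prop :=
  exists p, lorenz_field theta p = 0 /\ forall t, J t -> x t = p.

(* When 0 belongs to J, z0 is the value z(0). *)
Definition z_axis_trajectory (beta : R) J x : Prop :=
  exists z0, z0 != 0 /\
    forall t, J t -> x t = vec3 0 0 (expR (- beta * t) * z0).

Definition identifiable J x (i : 'I_3) : Prop :=
  forall theta1 theta2,
    lorenz_trajectory theta1 J x -> lorenz_trajectory theta2 J x ->
    theta1 0 i = theta2 0 i.

Definition singular_set : set 'rV[R]_3 :=
  [set p | [\/ yco p = xco p, xco p = 0 | zco p = 0]].

Definition away_set (delta : R) : set 'rV[R]_3 :=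
  [set p | delta <= euclid_dist p singular_set].

Definition well_posed (C : R -> R -> R) (delta : R) J : Prop :=
  forall theta1 theta2 x1 x2,
    lorenz_trajectory theta1 J x1 -> lorenz_trajectory theta2 J x2 ->
    C1bd J x1 -> C1bd J x2 ->
    (forall t, J t -> away_set delta (x1 t)) ->
    (forall t, J t -> away_set delta (x2 t)) ->
    enorm (theta1 - theta2) <=
      C delta (Num.max (C1bd_norm J x1) (C1bd_norm J x2)) *
      C1bd_norm J (fun t => x1 t - x2 t).

End Lorenz.

(* Main.v *)
Require Import Defs.
From HB Require Import structures.
From mathcomp Require Import all_boot all_order all_algebra.
From mathcomp Require Import all_classical all_reals all_analysis.
From mathcomp Require Import ring lra.
Set Implicit Arguments.
Unset Strict Implicit.
Unset Printing Implicit Defensive.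
Import Order.TTheory GRing.Theory Num.Theory.
Import numFieldNormedType.Exports.
Local Open Scope classical_set_scope.
Local Open Scope ring_scope.

(** Where y <> x, x <> 0 and z <> 0 the Lorenz equations can be solved for the
   parameters, which gives the formulas of (i); comparing the resulting
   quotients, whose denominators are at least delta in absolute value, at a
   single time already gives (W).  For (v), if a trajectory stayed in the
   singular set on an open interval, then x = 0, y = x or z = 0 on a smaller
   open interval; differentiating this relation along the flow shows that some
   point of the trajectory is an equilibrium or lies on the z-axis, and
   uniqueness for the initial value problem extends this to the whole time
   interval. *)

(** * Coordinates of three-vectors and elementary bounds for the Euclidean norm *)

Lemma forall_I3 (P : 'I_3 -> Prop) :
  P (inord 0) -> P (inord 1) -> P (inord 2) -> forall i, P i.
Proof.
move=> P0 P1 P2 [[|[|[|//]]] ilt].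
- by rewrite (_ : Ordinal ilt = inord 0) //; apply/val_inj; rewrite /= inordK.
- by rewrite (_ : Ordinal ilt = inord 1) //; apply/val_inj; rewrite /= inordK.
- by rewrite (_ : Ordinal ilt = inord 2) //; apply/val_inj; rewrite /= inordK.
Qed.

Section coordinates.
Context {R : realType}.
Implicit Types (p q theta : 'rV[R]_3) (a b c d : R).

Lemma xco_vec3 a b c : xco (vec3 a b c) = a.
Proof. by rewrite /xco mxE inordK. Qed.

Lemma yco_vec3 a b c : yco (vec3 a b c) = b.
Proof. by rewrite /yco mxE inordK. Qed.

Lemma zco_vec3 a b c : zco (vec3 a b c) = c.
Proof. by rewrite /zco mxE inordK. Qed.

Definition vec3E := (xco_vec3, yco_vec3, zco_vec3).

Lemma rV3P p q :
  xco p = xco q -> yco p = yco q -> zco p = zco q -> p = q.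
Proof. by move=> ? ? ?; apply/rowP; apply: forall_I3. Qed.

Lemma vec3_eta p : p = vec3 (xco p) (yco p) (zco p).
Proof. by apply: rV3P; rewrite vec3E. Qed.

Lemma xcoB p q : xco (p - q) = xco p - xco q. Proof. by rewrite /xco !mxE. Qed.
Lemma ycoB p q : yco (p - q) = yco p - yco q. Proof. by rewrite /yco !mxE. Qed.
Lemma zcoB p q : zco (p - q) = zco p - zco q. Proof. by rewrite /zco !mxE. Qed.

Definition coB := (xcoB, ycoB, zcoB).

Lemma enormE p : enorm p = Num.sqrt (xco p ^+ 2 + yco p ^+ 2 + zco p ^+ 2).
Proof.
have co (i : 'I_3) j : (i : nat) = j -> (j < 3)%N -> p 0 i = p 0 (inord j).
  by move=> eij j3; congr (p 0 _); apply/val_inj; rewrite /= inordK.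
rewrite /enorm /xco /yco /zco !big_ord_recl big_ord0 addr0 addrA.
by rewrite (co ord0 0) ?(co (lift ord0 ord0) 1)
  ?(co (lift ord0 (lift ord0 ord0)) 2).
Qed.

Lemma enorm_ge0 p : 0 <= enorm p. Proof. exact: sqrtr_ge0. Qed.

Lemma sqrtr_sum3_ge a b c d : `|d| ^+ 2 <= a ^+ 2 + b ^+ 2 + c ^+ 2 ->
  `|d| <= Num.sqrt (a ^+ 2 + b ^+ 2 + c ^+ 2).
Proof. by move=> dle; rewrite -[leLHS]ger0_norm // -sqrtr_sqr ler_wsqrtr. Qed.

Lemma xco_le_enorm p : `|xco p| <= enorm p.
Proof.
rewrite enormE; apply: sqrtr_sum3_ge.
by rewrite real_normK ?num_real // -addrA lerDl addr_ge0 ?sqr_ge0.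
Qed.

Lemma yco_le_enorm p : `|yco p| <= enorm p.
Proof.
rewrite enormE; apply: sqrtr_sum3_ge.
by rewrite real_normK ?num_real // addrAC lerDr addr_ge0 ?sqr_ge0.
Qed.

Lemma zco_le_enorm p : `|zco p| <= enorm p.
Proof.
rewrite enormE; apply: sqrtr_sum3_ge.
by rewrite real_normK ?num_real // lerDr addr_ge0 ?sqr_ge0.
Qed.

Lemma enorm_le_sum p : enorm p <= `|xco p| + `|yco p| + `|zco p|.
Proof.
rewrite enormE -[leRHS]ger0_norm ?addr_ge0 // -sqrtr_sqr ler_wsqrtr //.
rewrite -(real_normK (num_real (xco p))) -(real_normK (num_real (yco p))).
rewrite -(real_normK (num_real (zco p))).
have := normr_ge0 (xco p); have := normr_ge0 (yco p); have := normr_ge0 (zco p).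
nra.
Qed.

Lemma lorenz_fieldP theta p v : lorenz_field theta p = v ->
  [/\ xco v = theta 0 isigma * (yco p - xco p),
      yco v = xco p * (theta 0 irho - zco p) - yco p &
      zco v = xco p * yco p - theta 0 ibeta * zco p].
Proof. by move=> <-; rewrite /lorenz_field !vec3E. Qed.

End coordinates.

(** * Derivatives relative to an interval and their link with ordinary derivatives *)

Section derivative_on.
Context {R : realType}.
Implicit Types (J : set R) (x y : R -> 'rV[R]_3) (a b t : R) (i : 'I_3).

#[local] Instance within_punctured_filter J t : Filter (within J t^').
Proof. exact: within_filter. Qed.

Lemma derivative_onP J x t : derivable_on J x -> J t ->
  diff_quotient x t s @[s --> within J t^'] --> derivative_on J x t.
Proof. by move=> dx Jt; exact: dx. Qed.

(** Properness of this filter makes limits along [J] unique, so that [derivative_on] can be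
    computed. The interval contains a second point [c], and the segment from [t] to [c] enters every
    punctured neighbourhood of [t]. *)
Lemma nontrivial_interval_limit_point J t :
  nontrivial_interval J -> J t -> ProperFilter (within J t^').
Proof.
move=> [Ji [a [b [Ja Jb ab]]]] Jt; split => [|]; last exact: within_filter.
rewrite /within /= /dnbhs /within /= => /nbhs_ballP[e /= e0 te].
have [c [Jc ct]] : exists c, J c /\ c != t.
  have [at_|] := eqVneq a t; last by exists a.
  by exists b; split => //; rewrite gt_eqF // -at_.
(* The bound [k <= 1] keeps [t + k * (c - t)] between [t] and [c]; the other bound keeps it within
   [e / 2] of [t]. *)
pose k := Num.min 1 (e / 2 / `|c - t|).
have ct0 : 0 < `|c - t| by rewrite normr_gt0 subr_eq0.
have k0 : 0 < k by rewrite lt_min ltr01 !divr_gt0.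
have k1 : k <= 1 by rewrite ge_min lexx.
pose s := t + k * (c - t).
apply: (te s).
- rewrite /ball /= /s opprD addNKr normrN normrM gtr0_norm //.
  rewrite (@le_lt_trans _ _ (e / 2)) ?ltr_pdivrMr ?ltr_pMr ?ltr1n //.
  by rewrite -ler_pdivlMr // ge_min lexx orbT.
- by rewrite /s -subr_eq0 addrAC subrr add0r mulf_neq0 ?subr_eq0 // gt_eqF.
- have [ctl|ctg] := leP c t.
    by apply: (Ji c t) => //; rewrite /s; apply/andP; split; nra.
  by apply: (Ji t c) => //; rewrite /s; apply/andP; split; nra.
Qed.

Lemma derivative_onB J x y t :
  nontrivial_interval J -> derivable_on J x -> derivable_on J y -> J t ->
  derivative_on J (fun s => x s - y s) t =
  derivative_on J x t - derivative_on J y t.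
Proof.
move=> Ji dx dy Jt; have PF := nontrivial_interval_limit_point Ji Jt.
apply: cvg_lim => //.
rewrite (_ : diff_quotient _ t = diff_quotient x t - diff_quotient y t).
  by apply: cvgB; exact: derivative_onP.
apply/funext => s; rewrite !fctE /diff_quotient -scalerBr; congr (_ *: _).
by apply/rowP => i; rewrite !mxE; ring.
Qed.

Lemma cvg_coord (F : set_system R) {FF : Filter F} x (p : 'rV[R]_3) i :
  x s @[s --> F] --> p -> x s 0 i @[s --> F] --> p 0 i.
Proof.
by move=> xp; apply: (cvg_comp x (fun M : 'rV[R]_3 => M 0 i) xp);
  exact: coord_continuous.
Qed.

(** The increment of [x] is [s - t] times a convergent difference quotient, hence tends to 0. This
    covers endpoints of [J], where only a one-sided limit exists. *)
Lemma within_itv_continuous J x a b i : derivable_on J x -> `[a, b] `<=` J ->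
  {within `[a, b], continuous (fun s => x s 0 i)}.
Proof.
move=> dx abJ; apply/subspace_continuousP => t abt.
have Jt := abJ _ abt.
have dq := @cvg_coord _ (within_punctured_filter J t) (diff_quotient x t) _ i
  (derivative_onP dx Jt).
have st : (s - t) @[s --> within J t^'] --> (0 : R).
  rewrite -[X in _ --> X](subrr t); apply: cvgB; last exact: cvg_cst.
  by apply: cvg_within_filter; apply: cvg_within_filter; exact: cvg_id.
have h : (s - t) * diff_quotient x t s 0 i + x t 0 i @[s --> within J t^'] -->
    0 * derivative_on J x t 0 i + x t 0 i.
  by apply: cvgD; [exact: cvgM | exact: cvg_cst].
rewrite mul0r add0r in h.
apply/cvgrPdist_lt => e e0.
move: h => /cvgrPdist_lt /(_ e e0); rewrite !near_withinE => h.
near=> s => abs.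
have [->|st'] := eqVneq s t; first by rewrite subrr normr0.
have : J s by exact: abJ.
move: st'; near: s; apply: filterS h => s h st' /(h st').
rewrite /diff_quotient !mxE mulrA divff ?subr_eq0 //.
by rewrite mul1r subrK.
Unshelve. all: end_near. Qed.

(** Near an interior point the restriction to [J] is vacuous, so the relative derivative is the
    two-sided one. *)
Lemma is_derive_on J x a b t i : derivable_on J x -> `[a, b] `<=` J ->
  t \in `]a, b[ -> is_derive t 1 (fun s => x s 0 i) (derivative_on J x t 0 i).
Proof.
move=> dx abJ tab.
have Jt : J t by apply: abJ; exact: subset_itv_oo_cc.
have dq := @cvg_coord _ (within_punctured_filter J t) (diff_quotient x t) _ i
  (derivative_onP dx Jt).
suff h : h^-1 *: (x (h *: 1 + t) 0 i - x t 0 i) @[h --> 0^'] -->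
         derivative_on J x t 0 i.
  by split; [apply/cvg_ex; eexists; exact: h | exact: cvg_lim h].
apply/cvgrPdist_lt => e e0; move: dq => /cvgrPdist_lt /(_ e e0).
rewrite !near_withinE => dq.
have H : \forall s \near t, s != t ->
    `|derivative_on J x t 0 i - (s - t)^-1 * (x s 0 i - x t 0 i)| < e.
  apply: filterS2 dq (near_in_itvoo tab) => s dq sab st.
  have := dq st (abJ _ (subset_itv_oo_cc sab)).
  by rewrite /diff_quotient !mxE.
(* Substitution [s = h + t], from difference quotients in [s] to those in [h]. *)
rewrite (near_shift (0 : R) t) in H.
apply: filterS H => h; rewrite /= subr0 => H h0.
have := H; rewrite addrK [_%:A]mulr1; apply.
by rewrite -subr_eq0 addrK.
Qed.
End derivative_on.

(** * Gronwall's inequality with zero data, in both time directions *)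

Section gronwall.
Context {R : realType}.
Implicit Types (w dw : R -> R) (a b k t : R).

Lemma is_derive_expR_weight w k t (l : R) : is_derive t 1 w l ->
  is_derive t 1 (fun s => w s * expR (k * s)) ((l + k * w t) * expR (k * t)).
Proof.
move=> dw; have dk : is_derive t 1 (fun s => expR (k * s)) (expR (k * t) * k).
  apply: (@is_derive1_comp _ expR (fun s => k * s)).
  by apply: is_derive_eq; rewrite [_%:A]mulr1.
apply: is_derive_eq (is_deriveM dw dk) _.
by rewrite /GRing.scale /=; ring.
Qed.

Lemma within_continuous_expR_weight w k (A : set R) :
  {within A, continuous w} ->
  {within A, continuous (fun s => w s * expR (k * s))}.
Proof.
move=> cw s; apply: cvgM; first exact: cw.
apply: continuous_subspaceT => {}s.
apply: (continuous_comp (f := fun s => k * s)); last exact: continuous_expR.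
by apply: cvgM; [exact: cvg_cst | exact: cvg_id].
Qed.

(** The integrating factor gives [w t * expR (- k * t)] a nonpositive derivative; the mean value
    theorem then carries the sign from [a] to [b]. *)
Lemma gronwall0_forward w dw a b k : a <= b ->
  (forall t, t \in `]a, b[ -> is_derive t 1 w (dw t)) ->
  {within `[a, b], continuous w} ->
  (forall t, t \in `]a, b[ -> dw t <= k * w t) ->
  w a <= 0 -> w b <= 0.
Proof.
rewrite le_eqVlt => /predU1P[<- //|ab] derw cw dwle wa.
have [c cab /eqP] := MVT ab
  (fun t tab => is_derive_expR_weight (- k) (derw t tab))
  (within_continuous_expR_weight (k := - k) cw).
rewrite subr_eq => /eqP E.
rewrite -(pmulr_lle0 _ (expR_gt0 (- k * b))) E -[leRHS](addr0 0) lerD //.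
- rewrite mulr_le0_ge0 ?subr_ge0 ?(ltW ab) // mulr_le0_ge0 ?expR_ge0 //.
  by rewrite mulNr subr_le0 dwle.
- by rewrite mulr_le0_ge0 ?expR_ge0.
Qed.

(** Here [w t * expR (k * t)] is nondecreasing, so the sign at [b] passes back to [a]. *)
Lemma gronwall0_backward w dw a b k : a <= b ->
  (forall t, t \in `]a, b[ -> is_derive t 1 w (dw t)) ->
  {within `[a, b], continuous w} ->
  (forall t, t \in `]a, b[ -> - (k * w t) <= dw t) ->
  w b <= 0 -> w a <= 0.
Proof.
rewrite le_eqVlt => /predU1P[<- //|ab] derw cw dwge wb.
have [c cab /eqP] := MVT ab
  (fun t tab => is_derive_expR_weight k (derw t tab))
  (within_continuous_expR_weight (k := k) cw).
rewrite subr_eq addrC -subr_eq => /eqP E.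
rewrite -(pmulr_lle0 _ (expR_gt0 (k * a))) -E subr_le0.
rewrite (@le_trans _ _ 0) //; first by rewrite mulr_le0_ge0 ?expR_ge0.
rewrite mulr_ge0 ?subr_ge0 ?(ltW ab) // mulr_ge0 ?expR_ge0 //.
by rewrite -lerBlDr sub0r dwge.
Qed.

Lemma within_continuous_bounded w a b : {within `[a, b], continuous w} ->
  exists M, forall t, t \in `[a, b] -> `|w t| <= M.
Proof.
move=> cw; have [M [_ MP]] := compact_bounded
  (continuous_compact cw (@segment_compact R a b)).
(* Boundedness provides only the bounds strictly above [M], hence the choice [M + 1]. *)
exists (M + 1) => t tab; apply: (MP (M + 1)); first by rewrite ltrDl.
by exists t.
Qed.

End gronwall.

(** * Uniqueness for the initial value problem *)

Section uniqueness.
Context {R : realType}.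
Implicit Types (theta p : 'rV[R]_3) (J : set R) (x y : R -> 'rV[R]_3).
Implicit Types a b t : R.

(** Continuity up to the ends with two-sided derivatives inside is the form that the mean value
    theorem takes as input. *)
Definition solves_on theta a b x : Prop := forall i : 'I_3,
  {within `[a, b], continuous (fun t => x t 0 i)} /\
  forall t, t \in `]a, b[ ->
    is_derive t 1 (fun s => x s 0 i) (lorenz_field theta (x t) 0 i).

Lemma is_derive_sqrB (f g : R -> R) t df dg :
  is_derive t 1 f df -> is_derive t 1 g dg ->
  is_derive t 1 (fun s => (f s - g s) ^+ 2) (2 * ((f t - g t) * (df - dg))).
Proof.
move=> hf hg; apply: is_derive_eq (is_deriveX 2 (is_deriveB hf hg)) _.
by rewrite /GRing.scale /= expr1 mulrA.
Qed.

Lemma within_continuous_sqrB (A : set R) (f g : R -> R) :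
  {within A, continuous f} -> {within A, continuous g} ->
  {within A, continuous (fun s => (f s - g s) ^+ 2)}.
Proof.
move=> cf cg s; under eq_fun do rewrite expr2.
by apply: cvgM; (apply: cvgB; [exact: cf | exact: cg]).
Qed.

Definition sqdist p q : R :=
  (xco p - xco q) ^+ 2 + (yco p - yco q) ^+ 2 + (zco p - zco q) ^+ 2.

Lemma sqdist_le0 p q : sqdist p q <= 0 -> p = q.
Proof.
rewrite /sqdist => pq.
by apply: rV3P; apply/eqP; rewrite -subr_eq0 -sqrf_eq0 eq_le sqr_ge0 andbT;
  have := sqr_ge0 (xco p - xco q); have := sqr_ge0 (yco p - yco q);
  have := sqr_ge0 (zco p - zco q); lra.
Qed.

Lemma sqdistxx p : sqdist p p = 0.
Proof. by rewrite /sqdist !subrr expr0n /= !addr0. Qed.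

(* The derivative of [sqdist] along a pair of solutions. *)
Definition dsqdist theta p q : R :=
  let v := lorenz_field theta p in let u := lorenz_field theta q in
  2 * ((xco p - xco q) * (xco v - xco u)) +
  2 * ((yco p - yco q) * (yco v - yco u)) +
  2 * ((zco p - zco q) * (zco v - zco u)).

(* The two terms [xco q * (yco p - yco q) * (zco p - zco q)] cancel, so no bound
   on [q] is needed. *)
Lemma dsqdist_le theta p q (M : R) :
  `|yco p| <= M -> `|zco p| <= M ->
  `|dsqdist theta p q| <=
  (3 * `|theta 0 isigma| + `|theta 0 irho| + 2 + 2 * `|theta 0 ibeta| + 2 * M)
  * sqdist p q.
Proof.
move=> yM zM; set S := sqdist p q.
have mul_le (c e C E : R) : `|c| <= C -> `|e| <= E -> `|c * e| <= C * E.
  by move=> ? ?; rewrite normrM ler_pM.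
set d1 := xco p - xco q; set d2 := yco p - yco q; set d3 := zco p - zco q.
have S1 := sqr_ge0 d1; have S2 := sqr_ge0 d2; have S3 := sqr_ge0 d3.
have SE : S = d1 ^+ 2 + d2 ^+ 2 + d3 ^+ 2 by [].
(* The squares of [d1 + d2] and [d1 - d2] are nonnegative, which bounds the cross term by
   [d1 ^+ 2 + d2 ^+ 2]. *)
have S12 : `|2 * d1 * d2| <= S.
  by rewrite ler_norml SE; apply/andP; split;
    have := sqr_ge0 (d1 + d2); have := sqr_ge0 (d1 - d2); nra.
have S13 : `|2 * d1 * d3| <= S.
  by rewrite ler_norml SE; apply/andP; split;
    have := sqr_ge0 (d1 + d3); have := sqr_ge0 (d1 - d3); nra.
have -> : dsqdist theta p q =
    theta 0 isigma * (2 * d1 * d2 - 2 * d1 ^+ 2) +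
    theta 0 irho * (2 * d1 * d2) - 2 * d2 ^+ 2 -
    theta 0 ibeta * (2 * d3 ^+ 2) -
    zco p * (2 * d1 * d2) + yco p * (2 * d1 * d3).
  by rewrite /dsqdist /lorenz_field !vec3E /d1 /d2 /d3; ring.
have -> : (3 * `|theta 0 isigma| + `|theta 0 irho| + 2 + 2 * `|theta 0 ibeta|
    + 2 * M) * S = `|theta 0 isigma| * (3 * S) + `|theta 0 irho| * S + 2 * S +
    `|theta 0 ibeta| * (2 * S) + M * S + M * S by ring.
have d12 : `|2 * d1 * d2 - 2 * d1 ^+ 2| <= 3 * S.
  by rewrite (le_trans (ler_normB _ _)) // (ger0_norm (x := 2 * _)); nra.
have d22 : `|2 * d2 ^+ 2| <= 2 * S by rewrite ger0_norm; nra.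
have d32 : `|2 * d3 ^+ 2| <= 2 * S by rewrite ger0_norm; nra.
apply: le_trans (ler_normD _ _) _; apply: lerD; last exact: mul_le.
apply: le_trans (ler_normB _ _) _; apply: lerD; last exact: mul_le.
apply: le_trans (ler_normB _ _) _; apply: lerD; last exact: mul_le.
apply: le_trans (ler_normB _ _) _; apply: lerD; last exact: d22.
by apply: le_trans (ler_normD _ _) _; apply: lerD; exact: mul_le.
Qed.

(** The squared distance [w] satisfies [|w'| <= K * w], so Gronwall's inequality applies both
    forward and backward. The constant [K] is finite since the last two coordinates of [x] are
    bounded on the compact interval. *)
Lemma solves_on_sqdist theta a b x y : a <= b ->
  solves_on theta a b x -> solves_on theta a b y ->
  sqdist (x a) (y a) = 0 <-> sqdist (x b) (y b) = 0.
Proof.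
move=> ab sx sy.
have cw : {within `[a, b], continuous (fun t => sqdist (x t) (y t))}.
  move=> t; apply: cvgD; first apply: cvgD;
    apply: within_continuous_sqrB;
    by [exact: (sx _).1 | exact: (sy _).1].
have dw t : t \in `]a, b[ ->
    is_derive t 1 (fun t => sqdist (x t) (y t)) (dsqdist theta (x t) (y t)).
  move=> tab; apply: is_deriveD; first apply: is_deriveD;
    apply: is_derive_sqrB;
    by [exact: (sx _).2 | exact: (sy _).2].
have [M1 M1P] := within_continuous_bounded (sx (inord 1)).1.
have [M2 M2P] := within_continuous_bounded (sx (inord 2)).1.
set K := 3 * `|theta 0 isigma| + `|theta 0 irho| + 2 + 2 * `|theta 0 ibeta| +
  2 * Num.max M1 M2.
have dwle t : t \in `]a, b[ ->
    `|dsqdist theta (x t) (y t)| <= K * sqdist (x t) (y t).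
  move=> /subset_itv_oo_cc tab; apply: dsqdist_le.
    by rewrite le_max M1P.
  by rewrite le_max M2P ?orbT.
have sq0 p q : sqdist p q <= 0 -> sqdist p q = 0.
  by move/sqdist_le0 ->; exact: sqdistxx.
split=> w0; apply: sq0.
- apply: (gronwall0_forward (k := K) ab dw cw); last by rewrite w0.
  by move=> t /dwle; rewrite ler_norml => /andP[].
- apply: (gronwall0_backward (k := K) ab dw cw); last by rewrite w0.
  by move=> t /dwle; rewrite ler_norml => /andP[].
Qed.

Lemma itv_cc_subset J a b : is_interval J -> J a -> J b -> `[a, b] `<=` J.
Proof.
by move=> Ji Ja Jb t /=; rewrite in_itv /=; exact: Ji.
Qed.

Lemma trajectory_solves_on theta J a b x : `[a, b] `<=` J ->
  lorenz_trajectory theta J x -> solves_on theta a b x.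
Proof.
move=> abJ [[dx _] ode] i; split=> [|t tab].
  exact: within_itv_continuous abJ.
rewrite -ode; first exact: is_derive_on tab.
by apply: abJ; exact: subset_itv_oo_cc.
Qed.

(** The two curves are compared on the segment joining [t0] to [t], on either side of [t0]. The
    curve [y] solves the system on every segment, as the explicit solutions below do. *)
Lemma trajectory_unique theta J x y t0 :
  is_interval J -> lorenz_trajectory theta J x ->
  (forall a b, solves_on theta a b y) -> J t0 -> x t0 = y t0 ->
  forall t, J t -> x t = y t.
Proof.
move=> Ji trx sy Jt0 xy0 t Jt.
have w0 : sqdist (x t0) (y t0) = 0 by rewrite xy0 sqdistxx.
apply: sqdist_le0; have [tt0|/ltW t0t] := leP t t0.
- have sx := trajectory_solves_on (itv_cc_subset Ji Jt Jt0) trx.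
  by rewrite ((solves_on_sqdist tt0 sx (sy _ _)).2 w0).
- have sx := trajectory_solves_on (itv_cc_subset Ji Jt0 Jt) trx.
  by rewrite ((solves_on_sqdist t0t sx (sy _ _)).1 w0).
Qed.

Lemma solves_on_cst theta p a b :
  lorenz_field theta p = 0 -> solves_on theta a b (fun=> p).
Proof.
move=> f0 i; split=> [|t _]; first by move=> s; exact: cvg_cst.
by rewrite f0 mxE; exact: is_derive_cst.
Qed.

(** The z-axis is invariant under the flow, and on it the system reduces to [z' = - beta * z]. *)
Lemma solves_on_z_axis theta (c : R) a b :
  solves_on theta a b (fun t => vec3 0 0 (expR (- theta 0 ibeta * t) * c)).
Proof.
have z_axis (t : R) (k : R) :
    is_derive t 1 (fun s => expR (k * s) * c) (k * (expR (k * t) * c)).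
  have := is_derive_expR_weight k (@is_derive_cst _ R R c t 1).
  rewrite add0r -mulrA (mulrC c).
  by under eq_fun do rewrite mulrC.
set y := fun t => _.
have dy : forall (i : 'I_3) (t : R),
    is_derive t 1 (fun s => y s 0 i) (lorenz_field theta (y t) 0 i).
  apply: forall_I3 => t.
  - have -> : (fun s => y s 0 (inord 0)) = cst 0.
      by apply/funext => s; exact: xco_vec3.
    apply: is_derive_eq; rewrite -/(xco _) /lorenz_field /y.
    by rewrite !vec3E; ring.
  - have -> : (fun s => y s 0 (inord 1)) = cst 0.
      by apply/funext => s; exact: yco_vec3.
    apply: is_derive_eq; rewrite -/(yco _) /lorenz_field /y.
    by rewrite !vec3E; ring.
  - have -> : (fun s => y s 0 (inord 2)) =
        fun s => expR (- theta 0 ibeta * s) * c.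
      by apply/funext => s; exact: zco_vec3.
    apply: is_derive_eq; rewrite -/(zco _) /lorenz_field /y.
    by rewrite !vec3E; ring.
move=> i; split=> [|t _]; last exact: dy.
apply: derivable_within_continuous => t _.
exact: (dy i t).(@ex_derive _ _ _ _ _ _ _).
Qed.
End uniqueness.

(** * Distance to the singular set versus the three denominators *)

Section away.
Context {R : realType}.
Implicit Types (p q : 'rV[R]_3) (d : R).

Lemma euclid_dist_le (A : set 'rV[R]_3) p q : A q ->
  euclid_dist p A <= enorm (p - q).
Proof.
move=> Aq; apply: ge_inf; last by exists q.
by exists 0 => _ [r _ <-]; exact: enorm_ge0.
Qed.

(** Replacing [y] by [x], [x] by 0 or [z] by 0 gives a singular point at exactly the stated distance
    from [p], and the infimum is at most that. *)
Lemma away_set_ge d p : away_set d p ->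
  [/\ d <= `|yco p - xco p|, d <= `|xco p| & d <= `|zco p|].
Proof.
rewrite /away_set /= => dp; split; apply: le_trans dp _.
- have -> : `|yco p - xco p| = enorm (p - vec3 (xco p) (xco p) (zco p)).
    by rewrite enormE !coB !vec3E !subrr expr0n /= add0r addr0 sqrtr_sqr.
  by apply: euclid_dist_le; constructor 1; rewrite !vec3E.
- have -> : `|xco p| = enorm (p - vec3 0 (yco p) (zco p)).
    by rewrite enormE !coB !vec3E !subrr subr0 expr0n /= !addr0 sqrtr_sqr.
  by apply: euclid_dist_le; constructor 2; rewrite !vec3E.
- have -> : `|zco p| = enorm (p - vec3 (xco p) (yco p) 0).
    by rewrite enormE !coB !vec3E !subrr subr0 expr0n /= !add0r sqrtr_sqr.
  by apply: euclid_dist_le; constructor 3; rewrite !vec3E.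
Qed.

(** A converse with a loss of a factor 2: reaching the plane [y = x] changes [y - x] by at most
    twice the distance travelled. *)
Lemma away_set_half d p : 0 <= d ->
  d <= `|yco p - xco p| -> d <= `|xco p| -> d <= `|zco p| ->
  away_set (d / 2) p.
Proof.
move=> d0 dyx dx dz; apply: lb_le_inf.
  (* The origin is singular, so the infimum is over a nonempty set. *)
  by exists (enorm (p - 0)), 0 => //; constructor 2; rewrite /xco mxE.
move=> _ [q Sq <-].
have := xco_le_enorm (p - q); have := yco_le_enorm (p - q).
have := zco_le_enorm (p - q); rewrite !coB => zq yq xq.
case: Sq => [eyx|x0|z0].
- have : yco p - xco p = (yco p - yco q) - (xco p - xco q) by rewrite eyx; ring.
  move=> E; have := ler_normB (yco p - yco q) (xco p - xco q).
  by rewrite -E; lra.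
- by move: xq; rewrite x0 subr0; lra.
- by move: zq; rewrite z0 subr0; lra.
Qed.

End away.

(** * Recovery of the parameters and the stability estimate *)

Section estimate.
Context {R : realType}.
Implicit Types (theta : 'rV[R]_3) (J : set R) (x : R -> 'rV[R]_3).
Implicit Types (t delta D M : R).

Lemma lorenz_inverse theta p v : lorenz_field theta p = v ->
  yco p <> xco p -> xco p <> 0 -> zco p <> 0 ->
  [/\ theta 0 isigma = xco v / (yco p - xco p),
      theta 0 irho = (yco v + xco p * zco p + yco p) / xco p &
      theta 0 ibeta = (xco p * yco p - zco v) / zco p].
Proof.
move=> /lorenz_fieldP[-> -> ->] /eqP yx /eqP x0 /eqP z0.
split; [|field|field] => //.
by rewrite mulfK // subr_eq0.
Qed.

Lemma C1bd_norm_ge J x t : has_ubound [set enorm (x t) | t in J] ->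
  has_ubound [set enorm (derivative_on J x t) | t in J] -> J t ->
  enorm (x t) <= C1bd_norm J x /\ enorm (derivative_on J x t) <= C1bd_norm J x.
Proof.
move=> bx bdx Jt.
have xle : enorm (x t) <= sup [set enorm (x t) | t in J].
  by apply: ub_le_sup => //; exists t.
have dle : enorm (derivative_on J x t) <=
    sup [set enorm (derivative_on J x t) | t in J].
  by apply: ub_le_sup => //; exists t.
have := enorm_ge0 (x t); have := enorm_ge0 (derivative_on J x t).
by rewrite /C1bd_norm; lra.
Qed.

Lemma has_ubound_enormB J (f g : R -> 'rV[R]_3) :
  has_ubound [set enorm (f t) | t in J] ->
  has_ubound [set enorm (g t) | t in J] ->
  has_ubound [set enorm (f t - g t) | t in J].
Proof.
(* Each of the three coordinates of the difference is at most [F + G] in absolute value; a crude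
   bound suffices. *)
move=> [F Fub] [G Gub]; exists (3 * (F + G)) => _ [t Jt <-].
have Ft : enorm (f t) <= F by apply: Fub; exists t.
have Gt : enorm (g t) <= G by apply: Gub; exists t.
have := enorm_le_sum (f t - g t); rewrite !coB.
have := ler_normB (xco (f t)) (xco (g t)).
have := ler_normB (yco (f t)) (yco (g t)).
have := ler_normB (zco (f t)) (zco (g t)).
have := xco_le_enorm (f t); have := xco_le_enorm (g t).
have := yco_le_enorm (f t); have := yco_le_enorm (g t).
have := zco_le_enorm (f t); have := zco_le_enorm (g t).
lra.
Qed.

(** Over the common denominator [v1 * v2], of size at least [delta ^+ 2], the numerator is
    [(u1 - u2) * v2 - u2 * (v1 - v2)]. *)
Lemma quotientB_le (u1 u2 v1 v2 A B U V delta : R) : 0 < delta ->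
  delta <= `|v1| -> delta <= `|v2| ->
  `|u1 - u2| <= A -> `|u2| <= U -> `|v1 - v2| <= B -> `|v2| <= V ->
  `|u1 / v1 - u2 / v2| <= (A * V + U * B) / delta ^+ 2.
Proof.
move=> d0 dv1 dv2 uA uU vB vV.
have n1 : v1 != 0 by rewrite -normr_gt0 (lt_le_trans d0).
have n2 : v2 != 0 by rewrite -normr_gt0 (lt_le_trans d0).
have -> : u1 / v1 - u2 / v2 = ((u1 - u2) * v2 - u2 * (v1 - v2)) / (v1 * v2).
  by field; rewrite n1 n2.
rewrite normrM normfV; apply: ler_pM => //.
- rewrite (le_trans (ler_normB _ _)) // !normrM.
  by rewrite lerD // ler_pM.
- rewrite lef_pV2 ?posrE ?exprn_gt0 ?normr_gt0 ?mulf_neq0 //.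
  by rewrite expr2 normrM ler_pM // ltW.
Qed.

Lemma productB_le (u1 u2 v1 v2 M D : R) :
  `|v1| <= M -> `|u2| <= M -> `|u1 - u2| <= D -> `|v1 - v2| <= D ->
  `|u1 * v1 - u2 * v2| <= 2 * M * D.
Proof.
move=> v1M u2M uD vD.
have -> : u1 * v1 - u2 * v2 = (u1 - u2) * v1 + u2 * (v1 - v2) by ring.
rewrite (le_trans (ler_normD _ _)) // !normrM.
rewrite (_ : 2 * M * D = D * M + M * D); last by ring.
by rewrite lerD // ler_pM.
Qed.

(** The numerator is the sum of [4 * M] for sigma, [4 * M + 3 * M ^+ 2] for rho and
    [2 * M + 3 * M ^+ 2] for beta. *)
Definition well_posed_constant delta M : R :=
  (10 * M + 6 * M ^+ 2) / delta ^+ 2.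

(** A pointwise statement: [quotientB_le] is applied to each of the three inversion formulas, and
    the bounds are added. *)
Lemma parameter_estimate theta1 theta2 (p1 p2 v1 v2 : 'rV[R]_3) delta M D :
  0 < delta ->
  lorenz_field theta1 p1 = v1 -> lorenz_field theta2 p2 = v2 ->
  away_set delta p1 -> away_set delta p2 ->
  enorm p1 <= M -> enorm p2 <= M -> enorm v2 <= M ->
  enorm (p1 - p2) <= D -> enorm (v1 - v2) <= D ->
  enorm (theta1 - theta2) <= well_posed_constant delta M * D.
Proof.
move=> d0 f1 f2 /away_set_ge[yx1 x1 z1] /away_set_ge[yx2 x2 z2].
move=> p1M p2M v2M pD vD.
have nz (r : R) : delta <= `|r| -> r <> 0.
  by move=> dr r0; move: (lt_le_trans d0 dr); rewrite r0 normr0 ltxx.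
have nyx (p : 'rV[R]_3) : delta <= `|yco p - xco p| -> yco p <> xco p.
  by move=> /nz /eqP; rewrite subr_eq0 => /eqP.
have [s1 r1 b1] := lorenz_inverse f1 (nyx _ yx1) (nz _ x1) (nz _ z1).
have [s2 r2 b2] := lorenz_inverse f2 (nyx _ yx2) (nz _ x2) (nz _ z2).
have px1 := le_trans (xco_le_enorm _) p1M.
have py1 := le_trans (yco_le_enorm _) p1M.
have pz1 := le_trans (zco_le_enorm _) p1M.
have px2 := le_trans (xco_le_enorm _) p2M.
have py2 := le_trans (yco_le_enorm _) p2M.
have pz2 := le_trans (zco_le_enorm _) p2M.
have vx2 := le_trans (xco_le_enorm _) v2M.
have vy2 := le_trans (yco_le_enorm _) v2M.
have vz2 := le_trans (zco_le_enorm _) v2M.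
have pxD := le_trans (xco_le_enorm _) pD.
have pyD := le_trans (yco_le_enorm _) pD.
have pzD := le_trans (zco_le_enorm _) pD.
have vxD := le_trans (xco_le_enorm _) vD.
have vyD := le_trans (yco_le_enorm _) vD.
have vzD := le_trans (zco_le_enorm _) vD.
rewrite !coB in pxD pyD pzD vxD vyD vzD.
have M0 : 0 <= M by exact: le_trans px1.
have xz2 : `|xco p2 * zco p2| <= M * M by rewrite normrM ler_pM.
have xy2 : `|xco p2 * yco p2| <= M * M by rewrite normrM ler_pM.
have xzD := productB_le pz1 px2 pxD pzD.
have xyD := productB_le py1 px2 pxD pyD.
have sD : `|theta1 0 isigma - theta2 0 isigma| <=
    (D * (2 * M) + M * (2 * D)) / delta ^+ 2.
  rewrite s1 s2; apply: quotientB_le => //.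
  - have -> : yco p1 - xco p1 - (yco p2 - xco p2) =
      (yco p1 - yco p2) - (xco p1 - xco p2) by ring.
    by rewrite (le_trans (ler_normB _ _)) //; lra.
  - by rewrite (le_trans (ler_normB _ _)) //; lra.
have rD : `|theta1 0 irho - theta2 0 irho| <=
    ((D + 2 * M * D + D) * M + (M + M * M + M) * D) / delta ^+ 2.
  rewrite r1 r2; apply: quotientB_le => //.
  - rewrite (_ : _ - _ = (yco v1 - yco v2) +
      (xco p1 * zco p1 - xco p2 * zco p2) + (yco p1 - yco p2)); last by ring.
    by rewrite (le_trans (ler_normD _ _)) // lerD //
      (le_trans (ler_normD _ _)) // lerD.
  - by rewrite (le_trans (ler_normD _ _)) // lerD //
      (le_trans (ler_normD _ _)) // lerD.
have bD : `|theta1 0 ibeta - theta2 0 ibeta| <=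
    ((2 * M * D + D) * M + (M * M + M) * D) / delta ^+ 2.
  rewrite b1 b2; apply: quotientB_le => //.
  - rewrite (_ : _ - _ = (xco p1 * yco p1 - xco p2 * yco p2) -
      (zco v1 - zco v2)); last by ring.
    by rewrite (le_trans (ler_normB _ _)) // lerD.
  - by rewrite (le_trans (ler_normB _ _)) // lerD.
rewrite (le_trans (enorm_le_sum _)) // !coB.
apply: le_trans (lerD (lerD sD rD) bD) _.
rewrite /well_posed_constant le_eqVlt; apply/orP; left; apply/eqP; field.
exact: lt0r_neq0.
Qed.

Lemma well_posed_away delta J : 0 < delta -> nontrivial_interval J ->
  well_posed well_posed_constant delta J.
Proof.
move=> d0 Ji theta1 theta2 x1 x2 [[dx1 _] ode1] [[dx2 _] ode2].
move=> [_ bx1 bdx1] [_ bx2 bdx2] a1 a2.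
have [_ [t [_ [Jt _ _]]]] := Ji.
have [x1M dx1M] := C1bd_norm_ge bx1 bdx1 Jt.
have [x2M dx2M] := C1bd_norm_ge bx2 bdx2 Jt.
have dB s : J s -> derivative_on J (fun t => x1 t - x2 t) s =
    derivative_on J x1 s - derivative_on J x2 s by exact: derivative_onB.
(* A supremum dominates its set only when that set is bounded, so this is checked before the norm of
   the difference is used. *)
have bdB : has_ubound [set enorm (derivative_on J (fun t => x1 t - x2 t) s) | s in J].
  have [B BP] := has_ubound_enormB bdx1 bdx2.
  by exists B => _ [s Js <-]; rewrite dB //; apply: BP; exists s.
have [xD dxD] := C1bd_norm_ge (has_ubound_enormB bx1 bx2) bdB Jt.
rewrite dB // in dxD.
apply: (@parameter_estimate _ _ (x1 t) (x2 t) _ _ _ _ _ d0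
  (esym (ode1 t Jt)) (esym (ode2 t Jt)) (a1 t Jt) (a2 t Jt)) => //.
- by rewrite le_max x1M.
- by rewrite le_max x2M orbT.
- by rewrite le_max dx2M orbT.
Qed.

End estimate.

(** * Trajectories that remain in the singular set *)

Section degenerate.
Context {R : realType}.
Implicit Types (theta p : 'rV[R]_3) (J : set R) (x : R -> 'rV[R]_3).
Implicit Types (f : R -> R) (a b c d t : R).

(** Turns a property valid near [t] into one valid on an open interval, where identities can be
    differentiated. *)
Lemma itvoo_persist t a b (P : R -> Prop) : t \in `]a, b[ ->
  (\forall s \near t, P s) ->
  exists c d, (t \in `]c, d[) /\
    forall s, s \in `]c, d[ -> (s \in `]a, b[) /\ P s.
Proof.
move=> tab /(filterI (near_in_itvoo tab)) /nbhs_ballP[e /= e0 te].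
exists (t - e), (t + e); split=> [|s].
  by rewrite in_itv /=; apply/andP; split; lra.
by rewrite in_itv /= => ste; apply: te; rewrite /ball /= distrC ltr_distl.
Qed.

Lemma is_derive_continuous f t l : is_derive t 1 f l -> {for t, continuous f}.
Proof.
by move=> df; apply: differentiable_continuous; apply/derivable1_diffP.
Qed.

Lemma near_half_norm f t l : is_derive t 1 f l -> f t != 0 ->
  \forall s \near t, `|f t| / 2 <= `|f s|.
Proof.
move=> /is_derive_continuous cf ft0.
have e0 : 0 < `|f t| / 2 by rewrite divr_gt0 ?normr_gt0.
move: cf => /cvgrPdist_lt /(_ _ e0); apply: filterS => s fts.
by have := ler_normD (f s) (f t - f s); rewrite (addrC (f s)) subrK; lra.
Qed.

Lemma near_neq0 f t l : is_derive t 1 f l -> f t != 0 ->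
  \forall s \near t, f s != 0.
Proof.
move=> df ft0; apply: filterS (near_half_norm df ft0) => s.
by rewrite -!normr_gt0 in ft0 *; lra.
Qed.

(** This is the tool for differentiating a relation that holds along the trajectory. *)
Lemma is_derive_cst_on f t a b k l : t \in `]a, b[ ->
  (forall s, s \in `]a, b[ -> f s = k) -> is_derive t 1 f l -> l = 0.
Proof.
move=> tab fk df; rewrite -(@derive_val _ _ _ _ _ _ _ df).
rewrite (near_eq_derive (g := cst k)) ?derive_cst //.
by apply: filterS (near_in_itvoo tab) => s; exact: fk.
Qed.

Lemma lorenz_field_z_axis theta p : xco p = 0 -> yco p = 0 ->
  lorenz_field theta p = vec3 0 0 (- theta 0 ibeta * zco p).
Proof.
by move=> x0 y0; apply: rV3P; rewrite !vec3E x0 y0; ring.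
Qed.

Lemma z_axis_degenerate theta J x t :
  is_interval J -> lorenz_trajectory theta J x -> J t ->
  xco (x t) = 0 -> yco (x t) = 0 ->
  equilibrium_trajectory theta J x \/ z_axis_trajectory (theta 0 ibeta) J x.
Proof.
move=> Ji trx Jt x0 y0; have [z0|z0] := eqVneq (zco (x t)) 0.
- left; have f0 : lorenz_field theta (x t) = 0.
    rewrite (lorenz_field_z_axis _ x0 y0) z0 mulr0.
    by apply: rV3P; rewrite vec3E /xco /yco /zco mxE.
  exists (x t); split => //.
  exact: (trajectory_unique Ji trx (fun a b => solves_on_cst a b f0) Jt).
(* The exponential solution through [x t] at time [t] is traced back to time 0. *)
- right; set z1 := expR (theta 0 ibeta * t) * zco (x t).
  exists z1; split; first by rewrite mulf_neq0 // gt_eqF ?expR_gt0.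
  apply: (trajectory_unique Ji trx (solves_on_z_axis theta z1) Jt).
  rewrite [LHS]vec3_eta x0 y0 /z1 mulrA -expRD mulNr addNr expR0 mul1r.
  by [].
Qed.

Lemma singular_degenerate theta J x a b :
  theta 0 isigma <> 0 -> theta 0 irho <> 0 ->
  is_interval J -> lorenz_trajectory theta J x -> J a -> J b -> a < b ->
  (forall t, t \in `]a, b[ -> singular_set (x t)) ->
  equilibrium_trajectory theta J x \/ z_axis_trajectory (theta 0 ibeta) J x.
Proof.
move=> /eqP s0 /eqP r0 Ji trx Ja Jb ab sing.
have abJ := itv_cc_subset Ji Ja Jb.
have Jin t : t \in `]a, b[ -> J t by move/subset_itv_oo_cc/abJ.
have sx := trajectory_solves_on abJ trx.
pose X t := xco (x t); pose Y t := yco (x t); pose Z t := zco (x t).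
have dX t : t \in `]a, b[ -> is_derive t 1 X (theta 0 isigma * (Y t - X t)).
  by move=> /(sx (inord 0)).2; rewrite -/(xco _) /lorenz_field xco_vec3.
have dY t : t \in `]a, b[ ->
    is_derive t 1 Y (X t * (theta 0 irho - Z t) - Y t).
  by move=> /(sx (inord 1)).2; rewrite -/(yco _) /lorenz_field yco_vec3.
have dZ t : t \in `]a, b[ -> is_derive t 1 Z (X t * Y t - theta 0 ibeta * Z t).
  by move=> /(sx (inord 2)).2; rewrite -/(zco _) /lorenz_field zco_vec3.
have dYX t (tab : t \in `]a, b[) := is_deriveB (dY t tab) (dX t tab).
have mid : (a + b) / 2 \in `]a, b[ by rewrite in_itv /=; apply/andP; split; lra.
have [[t [tab Xt0]]|X0] := pselect (exists t, (t \in `]a, b[) /\ X t != 0); last first.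
  (* If [x] vanishes identically, then [0 = x' = sigma * y] and [sigma <> 0] put the trajectory on
     the z-axis. *)
  have {}X0 t : t \in `]a, b[ -> X t = 0.
    by move=> tab; apply/eqP/negP => /negP Xt; apply: X0; exists t.
  apply: (z_axis_degenerate Ji trx (Jin _ mid)); first exact: X0.
  have := is_derive_cst_on mid X0 (dX _ mid).
  by rewrite (X0 _ mid) subr0 => /eqP; rewrite mulf_eq0 (negPf s0) => /eqP.
have [c [d [tcd cdP]]] := itvoo_persist tab (near_neq0 (dX _ tab) Xt0).
have [[s [scd YXs]]|YX] :=
  pselect (exists s, (s \in `]c, d[) /\ Y s - X s != 0).
(* Where [x <> 0] and [y <> x], only [z = 0] remains. Then [0 = z' = x * y] gives [y = 0], and
   [0 = y' = rho * x] contradicts [rho <> 0]. *)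
- have [sab Xs0] := cdP _ scd.
  have [c' [d' [scd' cdP']]] := itvoo_persist scd (near_neq0 (dYX _ sab) YXs).
  have Z0 u : u \in `]c', d'[ -> Z u = 0.
    move=> /cdP'[/cdP[uab Xu] YXu]; case: (sing _ uab) => // E.
    + have : yco (x u) - xco (x u) != 0 by exact: YXu.
      by rewrite E subrr eqxx.
    + have : xco (x u) != 0 by exact: Xu.
      by rewrite E eqxx.
  have Y0 u : u \in `]c', d'[ -> Y u = 0.
    move=> ucd; have [/cdP[uab Xu] _] := cdP' _ ucd.
    have := is_derive_cst_on ucd Z0 (dZ _ uab).
    rewrite (Z0 _ ucd) mulr0 subr0 => /eqP.
    by rewrite mulf_eq0 (negPf Xu) => /eqP.
  have := is_derive_cst_on scd' Y0 (dY _ sab).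
  rewrite (Y0 _ scd') (Z0 _ scd') !subr0 => /eqP.
  by rewrite mulf_eq0 (negPf Xs0) (negPf r0).
(* With [y = x] throughout, [x' = 0], hence [y' = 0], hence [z] is the constant [rho - 1]. All three
   derivatives vanish, so the point is an equilibrium. *)
- have {}YX s : s \in `]c, d[ -> Y s - X s = 0.
    by move=> scd; apply/eqP/negP => /negP YXs; apply: YX; exists s.
  have dY0 s : s \in `]c, d[ -> X s * (theta 0 irho - Z s) - Y s = 0.
    move=> scd; have [sab _] := cdP _ scd.
    have := is_derive_cst_on scd YX (dYX _ sab).
    by rewrite (YX _ scd) mulr0 subr0.
  have Zr s : s \in `]c, d[ -> Z s = theta 0 irho - 1.
    move=> scd; have [_ Xs] := cdP _ scd.
    apply: (mulfI Xs); have := dY0 _ scd; have := YX _ scd; lra.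
  left; exists (x t).
  have f0 : lorenz_field theta (x t) = 0.
    apply: rV3P; rewrite !vec3E.
    + by rewrite [yco _ - _](YX _ tcd) mulr0 /xco mxE.
    + by rewrite [LHS](dY0 _ tcd) /yco mxE.
    + by rewrite [LHS](is_derive_cst_on tcd Zr (dZ _ tab)) /zco mxE.
  split=> //.
  exact: (trajectory_unique Ji trx (fun a b => solves_on_cst a b f0) (Jin _ tab)).
Qed.

Lemma away_subinterval theta J x a b t :
  `[a, b] `<=` J -> lorenz_trajectory theta J x -> t \in `]a, b[ ->
  ~ singular_set (x t) ->
  exists (I : set R) (delta : R), [/\ nontrivial_interval I, I `<=` J,
    0 < delta & forall s, I s -> away_set delta (x s)].
Proof.
move=> abJ trx tab nsing.
have sx := trajectory_solves_on abJ trx.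
have dx i : is_derive t 1 (fun s => x s 0 i) _ := (sx i).2 t tab.
have nyx : yco (x t) - xco (x t) != 0.
  by rewrite subr_eq0; apply/eqP => E; apply: nsing; constructor 1.
have nx : xco (x t) != 0 by apply/eqP => E; apply: nsing; constructor 2.
have nz : zco (x t) != 0 by apply/eqP => E; apply: nsing; constructor 3.
pose m := Num.min `|yco (x t) - xco (x t)| (Num.min `|xco (x t)| `|zco (x t)|).
have m0 : 0 < m by rewrite !lt_min !normr_gt0 nyx nx nz.
have m1 : m <= `|yco (x t) - xco (x t)| by rewrite ge_min lexx.
have m2 : m <= `|xco (x t)| by rewrite !ge_min lexx orbT.
have m3 : m <= `|zco (x t)| by rewrite !ge_min lexx !orbT.
(* One half is lost to continuity of the three denominators, the other in passing from them to the
   distance. *)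
have near_away : \forall s \near t, away_set (m / 2 / 2) (x s).
  apply: filterS3 (near_half_norm (is_deriveB (dx (inord 1)) (dx (inord 0))) nyx)
    (near_half_norm (dx (inord 0)) nx) (near_half_norm (dx (inord 2)) nz).
  move=> s h1 h2 h3; apply: away_set_half; first lra.
  - by apply: le_trans h1; rewrite ler_pM2r ?invr_gt0.
  - by apply: le_trans h2; rewrite ler_pM2r ?invr_gt0.
  - by apply: le_trans h3; rewrite ler_pM2r ?invr_gt0.
have [c [d [tcd cdP]]] := itvoo_persist tab near_away.
exists `]c, d[%classic, (m / 2 / 2); split.
- split; first exact: interval_is_interval.
  move: tcd; rewrite in_itv /= => /andP[ct td].
  by exists t, ((t + d) / 2); split; rewrite /= ?in_itv /= ?ct ?td //; lra.
- by move=> s /cdP[/subset_itv_oo_cc/abJ].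
- by rewrite !divr_gt0.
- by move=> s /cdP[].
Qed.

End degenerate.

(** * Criteria for a parameter to be identifiable or not *)

Section identifiability.
Context {R : realType}.
Implicit Types (theta p : 'rV[R]_3) (J : set R) (x : R -> 'rV[R]_3).

(** Adding 1 to component [i] produces a second parameter vector for which the same curve is a
    solution. *)
Lemma not_identifiable theta J x i : lorenz_trajectory theta J x ->
  (forall t, J t ->
    lorenz_field (theta + delta_mx 0 i) (x t) = lorenz_field theta (x t)) ->
  ~ identifiable J x i.
Proof.
move=> trx fE /(_ (theta + delta_mx 0 i) theta) H.
have : (theta + delta_mx 0 i) 0 i = theta 0 i.
  apply: H => //; split; first exact: trx.1.
  by move=> t Jt; rewrite fE //; exact: trx.2.
rewrite !mxE !eqxx /= -[RHS]addr0 => /addrI/eqP; by rewrite oner_eq0.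
Qed.

Lemma inord3_eq (i j : nat) : (i < 3)%N -> (j < 3)%N ->
  (inord i == inord j :> 'I_3) = (i == j).
Proof. by move=> i3 j3; rewrite -val_eqE /= !inordK. Qed.

(** In the field sigma multiplies [y - x], rho multiplies [x] and beta multiplies [z]; a parameter
    is invisible where its factor vanishes. *)
Lemma lorenz_field_sigma theta p : xco p = yco p ->
  lorenz_field (theta + delta_mx 0 isigma) p = lorenz_field theta p.
Proof.
move=> xy; apply: rV3P; rewrite !vec3E !mxE ?inord3_eq //= ?addr0 //.
by rewrite xy subrr !mulr0.
Qed.

Lemma lorenz_field_rho theta p : xco p = 0 ->
  lorenz_field (theta + delta_mx 0 irho) p = lorenz_field theta p.
Proof.
move=> x0; apply: rV3P; rewrite !vec3E !mxE ?inord3_eq //= ?addr0 //.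
by rewrite x0 !mul0r.
Qed.

Lemma lorenz_field_beta theta p : zco p = 0 ->
  lorenz_field (theta + delta_mx 0 ibeta) p = lorenz_field theta p.
Proof.
move=> z0; apply: rV3P; rewrite !vec3E !mxE ?inord3_eq //= ?addr0 //.
by rewrite z0 !mulr0.
Qed.

(** Both parameter vectors give the same derivative at [t]; equating the third components and
    cancelling [z] leaves equal values of beta. *)
Lemma identifiable_beta J x t : J t -> zco (x t) <> 0 -> identifiable J x ibeta.
Proof.
move=> Jt /eqP z0 theta1 theta2 [_ ode1] [_ ode2].
have [_ _ e1] := lorenz_fieldP (esym (ode1 t Jt)).
have [_ _ e2] := lorenz_fieldP (esym (ode2 t Jt)).
by apply: (mulIf z0); lra.
Qed.

Lemma identifiable_rho J x t : J t -> xco (x t) <> 0 -> identifiable J x irho.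
Proof.
move=> Jt /eqP x0 theta1 theta2 [_ ode1] [_ ode2].
have [_ e1 _] := lorenz_fieldP (esym (ode1 t Jt)).
have [_ e2 _] := lorenz_fieldP (esym (ode2 t Jt)).
by apply: (mulfI x0); lra.
Qed.

End identifiability.

Theorem theorem2 (R : realType) :
  (* (i) *)
  (forall (theta : 'rV[R]_3) (J : set R) (x : R -> 'rV[R]_3) (t0 : R),
    nontrivial_interval J -> lorenz_trajectory theta J x -> J t0 ->
    let p := x t0 in
    let v := derivative_on J x t0 in
    yco p <> xco p -> xco p <> 0 -> zco p <> 0 ->
    [/\ theta 0 isigma = xco v / (yco p - xco p),
        theta 0 irho = (yco v + xco p * zco p + yco p) / xco p,
        theta 0 ibeta = (xco p * yco p - zco v) / zco p &
        forall (theta' : 'rV[R]_3) (J' : set R) (x' : R -> 'rV[R]_3),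
          nontrivial_interval J' -> lorenz_trajectory theta' J' x' -> J' t0 ->
          x' t0 = p -> derivative_on J' x' t0 = v -> theta' = theta]) /\
  exists C : R -> R -> R,
  [/\ (* (ii) *)
      forall (delta : R) (J : set R),
        0 < delta -> nontrivial_interval J -> well_posed C delta J,
      (* (iii) *)
      (forall (theta : 'rV[R]_3) (J : set R) (x : R -> 'rV[R]_3),
        nontrivial_interval J -> lorenz_trajectory theta J x ->
        (forall t, J t -> x t = vec3 0 0 0) ->
        [/\ ~ identifiable J x isigma, ~ identifiable J x irho
          & ~ identifiable J x ibeta]) /\
      (forall (theta : 'rV[R]_3) (J : set R) (x : R -> 'rV[R]_3) (eps : R),
        nontrivial_interval J -> lorenz_trajectory theta J x ->
        let rho := theta 0 irho in
        let beta := theta 0 ibeta in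
        1 < rho -> 0 < beta -> eps = 1 \/ eps = -1 ->
        (forall t, J t -> x t = vec3 (eps * Num.sqrt (beta * (rho - 1)))
                                     (eps * Num.sqrt (beta * (rho - 1)))
                                     (rho - 1)) ->
        [/\ identifiable J x ibeta, identifiable J x irho
          & ~ identifiable J x isigma]),
      (* (iv) *)
      forall (theta : 'rV[R]_3) (J : set R) (x : R -> 'rV[R]_3),
        nontrivial_interval J -> lorenz_trajectory theta J x ->
        z_axis_trajectory (theta 0 ibeta) J x ->
        [/\ identifiable J x ibeta, ~ identifiable J x isigma
          & ~ identifiable J x irho] &
      (* (v) *)
      forall (theta : 'rV[R]_3) (J : set R) (x : R -> 'rV[R]_3),
        theta 0 isigma <> 0 -> theta 0 irho <> 0 ->
        nontrivial_interval J -> lorenz_trajectory theta J x ->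
        ~ equilibrium_trajectory theta J x ->
        ~ z_axis_trajectory (theta 0 ibeta) J x ->
        exists (I : set R) (delta : R),
          [/\ nontrivial_interval I, I `<=` J, 0 < delta,
              forall t, I t -> away_set delta (x t) & well_posed C delta I]].

Proof.
split.
  move=> theta J x t0 Ji [_ ode] Jt0 p v yx x0 z0.
  have [e1 e2 e3] := lorenz_inverse (esym (ode t0 Jt0)) yx x0 z0.
  split=> // theta' J' x' Ji' [_ ode'] Jt0' xp xv.
  (* The second parameter vector satisfies the same equations at the same data, so the same formulas
     give all its components. *)
  have f' : lorenz_field theta' p = v by rewrite -xp -xv ode'.
  have [e1' e2' e3'] := lorenz_inverse f' yx x0 z0.
  by apply: rV3P; [rewrite [LHS]e1' [RHS]e1 | rewrite [LHS]e2' [RHS]e2 |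
    rewrite [LHS]e3' [RHS]e3].
exists well_posed_constant; split.
- by move=> delta J; exact: well_posed_away.
- split=> [theta J x Ji trx x0|theta J x eps Ji trx rho beta rho1 beta0 eps1 xE].
    by split; apply: (not_identifiable trx) => t Jt;
      [apply: lorenz_field_sigma|apply: lorenz_field_rho|
       apply: lorenz_field_beta]; rewrite x0 // ?vec3E.
  have [_ [t [_ [Jt _ _]]]] := Ji.
  split.
  + apply: (identifiable_beta Jt); rewrite xE // vec3E; lra.
  + apply: (identifiable_rho Jt); rewrite xE // vec3E; apply/eqP.
    rewrite mulf_neq0 ?sqrtr_eq0 -?ltNge ?mulr_gt0 ?subr_gt0 //.
    by case: eps1 => ->; rewrite ?oppr_eq0 oner_eq0.
  + by apply: (not_identifiable trx) => s Js; apply: lorenz_field_sigma;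
      rewrite xE // ?vec3E.
- move=> theta J x Ji trx [z0 [z00 xE]].
  have [_ [t [_ [Jt _ _]]]] := Ji.
  split.
  + apply: (identifiable_beta Jt); rewrite xE // vec3E; apply/eqP.
    by rewrite mulf_neq0 // gt_eqF ?expR_gt0.
  + by apply: (not_identifiable trx) => s Js; apply: lorenz_field_sigma;
      rewrite xE // ?vec3E.
  + by apply: (not_identifiable trx) => s Js; apply: lorenz_field_rho;
      rewrite xE // ?vec3E.
- move=> theta J x s0 r0 Ji trx neq nz.
  have [Jint [a [b [Ja Jb ab]]]] := Ji.
  (* Either some interior time is nonsingular, and a neighbourhood of it serves as [I], or the whole
     open interval is singular, which forces one of the two excluded kinds of trajectory. *)
  have [[t [tab nsing]]|sing] :=
    pselect (exists t, (t \in `]a, b[) /\ ~ singular_set (x t)).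
  + have [I [delta [Ii IJ d0 aw]]] :=
      away_subinterval (itv_cc_subset Jint Ja Jb) trx tab nsing.
    by exists I, delta; split=> //; exact: well_posed_away.
  + have {}sing t : t \in `]a, b[ -> singular_set (x t).
      by move=> tab; apply: contrapT => nsing; apply: sing; exists t.
    by have [] := singular_degenerate s0 r0 Jint trx Ja Jb ab sing.
Qed.
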